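(* A (nondegenerate) triangle in the Euclidean plane is determined uniquely up to congruence by its area $A$, its perimeter $P$ and the sum $R$ of the reciprocals of its angles. That is, if two triangles in $\mathbb{R}^2$ have the same area, the same perimeter, and the same value of $R = \frac{1}{\alpha}+\frac{1}{\beta}+\frac{1}{\gamma}$, where $\alpha,\beta,\gamma$ denote the interior angles of the respective triangle, then the two triangles are congruent.
   Context: Angles are measured in radians, so the interior angles of a triangle are positive and satisfy $\alpha+\beta+\gamma=\pi$. Two triangles are congruent if one is mapped to the other by an isometry of the plane (reflections allowed). *)

(* Defs.v *)
From Stdlib Require Import Reals.
Open Scope R_scope.

Definition point : Type := (R * R)%type.

Definition pdist (p q : point) : R := dist_euc (fst p) (snd p) (fst q) (snd q).

Definition collinear (p q r : point) : Prop :=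
  exists a b c : R, (a <> 0 \/ b <> 0) /\
    a * fst p + b * snd p = c /\
    a * fst q + b * snd q = c /\
    a * fst r + b * snd r = c.

Record plane_triangle : Type := PlaneTriangle {
  vA : point;
  vB : point;
  vC : point;
  nondegenerate : ~ collinear vA vB vC
}.

(** The closed triangle as a subset of the plane: the convex hull of the
    vertices. *)
Definition region (T : plane_triangle) (p : point) : Prop :=
  exists s t u : R, 0 <= s /\ 0 <= t /\ 0 <= u /\ s + t + u = 1 /\
    fst p = s * fst (vA T) + t * fst (vB T) + u * fst (vC T) /\
    snd p = s * snd (vA T) + t * snd (vB T) + u * snd (vC T).

(** Half the absolute value of the determinant of the edge vectors
    [vB - vA] and [vC - vA]. *)
Definition area (T : plane_triangle) : R :=
  Rabs ((fst (vB T) - fst (vA T)) * (snd (vC T) - snd (vA T))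
        - (snd (vB T) - snd (vA T)) * (fst (vC T) - fst (vA T))) / 2.

Definition perimeter (T : plane_triangle) : R :=
  pdist (vA T) (vB T) + pdist (vB T) (vC T) + pdist (vC T) (vA T).

(** Unoriented angle, in [[0, PI]], at the apex [p] between the rays towards
    [q] and [r]; meaningful when [q <> p] and [r <> p]. *)
Definition angle (q p r : point) : R :=
  acos (((fst q - fst p) * (fst r - fst p) + (snd q - snd p) * (snd r - snd p))
        / (pdist p q * pdist p r)).

Definition alpha (T : plane_triangle) : R := angle (vB T) (vA T) (vC T).
Definition beta (T : plane_triangle) : R := angle (vC T) (vB T) (vA T).
Definition gamma (T : plane_triangle) : R := angle (vA T) (vC T) (vB T).

Definition sum_recip_angles (T : plane_triangle) : R :=
  1 / alpha T + 1 / beta T + 1 / gamma T.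

Definition isometry (f : point -> point) : Prop :=
  forall p q : point, pdist (f p) (f q) = pdist p q.

(** The image of one triangle, as a point set, is the other: the vertices may
    be matched in any order, and [f] may reverse orientation. *)
Definition congruent (T1 T2 : plane_triangle) : Prop :=
  exists f : point -> point, isometry f /\
    forall q : point, region T2 q <-> exists p : point, region T1 p /\ f p = q.

(* Main.v *)
Require Import Defs.
From Stdlib Require Import Reals Lra.
From Coquelicot Require Import Coquelicot.
Open Scope R_scope.

(** Write [x], [y], [z] for the half-angles of a triangle of area [A] and
    semiperimeter [s].  They lie in [(0, PI/2)], and the classical formula
    [cot x = s (s - a) / A], with [a] the opposite side ([cot_half_angles]),
    turns the hypotheses into three equations:
    [x + y + z = PI/2], [cot x + cot y + cot z = s^2 / A] and
    [1/x + 1/y + 1/z = 2 R].  So it is enough that a triple in [(0, PI/2)] is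
    determined, up to order, by the sums over it of the three functions [x],
    [cot x], [1/x] ([sorted_triple_unique]): the formula then returns the
    sides, and triangles with equal sides are congruent ([congruent_SSS]).

    For the uniqueness, sort two triples [a <= b <= c] and [a' <= b' <= c']
    with the same three sums.  The differences [a' - a], [b' - b], [c' - c]
    change sign at most twice.

    If they change sign at most once, then one triple is more spread out than
    the other, and strict convexity of [cot] makes the sums of cotangents
    differ unless the triples coincide ([single_crossing]).

    If they change sign twice, say [a <= a' <= b' < b <= c < c'], we look for a
    combination [F] of [x], [cot x] and [1/x] which decreases up to [b'],
    increases from [b'] to [b] and decreases afterwards: each of the three
    moves [a -> a'], [b -> b'], [c -> c'] lowers [F] or keeps it, and the
    second one lowers it strictly, against the equality of the sums
    ([double_crossing]).  Such an [F] exists because the derivatives [1],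
    [1/sin^2], [1/x^2] form a Chebyshev system: [1/x^2], seen as a function of
    [1/sin^2 x], has slope [sin^3 x / (x^3 cos x)], and this slope is strictly
    monotone ([slope_increasing]), so that the graph is strictly curved and a
    chord cuts it in its two end points only, with a change of side at each
    ([chord_signs]).  The monotonicity of the slope is the Cusa-Huygens
    inequality [3 sin u < u (2 + cos u)] at [u = 2 x]. *)

(** * Monotonicity from the derivative *)

Lemma lt_of_deriv_pos (f f' : R -> R) (a b : R) :
  a < b ->
  (forall x, a <= x <= b -> is_derive f x (f' x)) ->
  (forall x, a < x < b -> 0 < f' x) ->
  f a < f b.
Proof.
  intros Hab Hd Hpos.
  destruct (MVT_cor2 f f' a b Hab) as [x [Hx Hin]].
  { intros x Hx. apply is_derive_Reals. auto. }
  specialize (Hpos x Hin). nra.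
Qed.

Lemma gt_of_deriv_neg (f f' : R -> R) (a b : R) :
  a < b ->
  (forall x, a <= x <= b -> is_derive f x (f' x)) ->
  (forall x, a < x < b -> f' x < 0) ->
  f b < f a.
Proof.
  intros Hab Hd Hneg.
  destruct (MVT_cor2 f f' a b Hab) as [x [Hx Hin]].
  { intros x Hx. apply is_derive_Reals. auto. }
  specialize (Hneg x Hin). nra.
Qed.

(** * The Cusa-Huygens inequality *)

Definition cot (x : R) : R := cos x / sin x.

Lemma sin_cos_pos (x : R) : 0 < x < PI / 2 -> 0 < sin x /\ 0 < cos x.
Proof.
  intros Hx. pose proof PI_RGT_0. split.
  - apply sin_gt_0; lra.
  - apply cos_gt_0; lra.
Qed.

Lemma sin_gt_x_cos (x : R) : 0 < x < PI / 2 -> x * cos x < sin x.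
Proof.
  intros Hx.
  assert (H : sin 0 - 0 * cos 0 < sin x - x * cos x).
  { apply (lt_of_deriv_pos (fun t => sin t - t * cos t) (fun t => t * sin t)).
    - lra.
    - intros t _. auto_derive; [trivial | ring].
    - intros t Ht. destruct (sin_cos_pos t); [lra | nra]. }
  rewrite sin_0 in H. lra.
Qed.

(** With [u = 2 x] this is [3 sin u < u (2 + cos u)]; the difference of the
    two sides has derivative [4 sin x (sin x - x cos x)]. *)
Lemma cusa_huygens (x : R) :
  0 < x < PI / 2 -> 3 * sin x * cos x < x * (1 + 2 * cos x ^ 2).
Proof.
  intros Hx.
  assert (H : 0 * (1 + 2 * cos 0 ^ 2) - 3 * sin 0 * cos 0
              < x * (1 + 2 * cos x ^ 2) - 3 * sin x * cos x).
  { apply (lt_of_deriv_pos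
             (fun t => t * (1 + 2 * cos t ^ 2) - 3 * sin t * cos t)
             (fun t => 4 * sin t * (sin t - t * cos t))).
    - lra.
    - intros t _. auto_derive; [trivial |].
      pose proof (sin2_cos2 t) as E. unfold Rsqr in E. nra.
    - intros t Ht. destruct (sin_cos_pos t) as [Hs _]; [lra |].
      pose proof (sin_gt_x_cos t). nra. }
  rewrite sin_0 in H. lra.
Qed.

(** * A Chebyshev system *)

(** The slope of [1 / x ^ 2] as a function of [1 / sin x ^ 2]. *)
Definition slope (x : R) : R := sin x ^ 3 / (x ^ 3 * cos x).

(** The derivative of [slope] has the sign of the gap in [cusa_huygens]. *)
Lemma slope_increasing (x y : R) :
  0 < x -> x < y -> y < PI / 2 -> slope x < slope y.
Proof.
  intros Hx Hxy Hy.
  apply (lt_of_deriv_pos slope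
           (fun t => sin t ^ 2 * (t * (1 + 2 * cos t ^ 2) - 3 * sin t * cos t)
                     / (t ^ 4 * cos t ^ 2))); auto.
  - intros t Ht. destruct (sin_cos_pos t) as [Hs Hc]; [lra |].
    unfold slope. auto_derive.
    + repeat apply Rmult_integral_contrapositive_currified; lra.
    + replace (1 + 2 * cos t ^ 2) with (3 * cos t ^ 2 + sin t ^ 2)
        by (pose proof (sin2_cos2 t) as E; unfold Rsqr in E; nra).
      field. lra.
  - intros t Ht. destruct (sin_cos_pos t) as [Hs Hc]; [lra |].
    pose proof (cusa_huygens t).
    apply Rdiv_lt_0_compat; apply Rmult_lt_0_compat;
      try (apply pow_lt; lra); lra.
Qed.

(** The height of the curve of points [(1 / sin x ^ 2, 1 / x ^ 2)] over the
    line of slope [m] and intercept [l]. *)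
Definition above_chord (l m x : R) : R := 1 / x ^ 2 - l - m / sin x ^ 2.

Lemma is_derive_above_chord (l m x : R) :
  0 < x < PI / 2 ->
  is_derive (above_chord l m) x (2 * cos x / sin x ^ 3 * (m - slope x)).
Proof.
  intros Hx. destruct (sin_cos_pos x Hx) as [Hs Hc].
  unfold above_chord, slope. auto_derive.
  - repeat split; repeat apply Rmult_integral_contrapositive_currified; lra.
  - field. lra.
Qed.

(** Choose [l] and [m] so that the chord passes through the points of
    parameters [p] and [q].  By the mean value theorem [m] is the slope at some
    [xi] between [p] and [q]; as the slope increases, [above_chord] increases
    up to [xi] and decreases beyond. *)
Lemma chord_signs (p q : R) :
  0 < p -> p < q -> q < PI / 2 ->
  exists l m : R,
    (forall x, 0 < x < p -> above_chord l m x < 0) /\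
    (forall x, p < x < q -> 0 < above_chord l m x) /\
    (forall x, q < x < PI / 2 -> above_chord l m x < 0).
Proof.
  intros Hp Hpq Hq.
  destruct (sin_cos_pos p) as [Hsp _]; [lra |].
  destruct (sin_cos_pos q) as [Hsq _]; [lra |].
  assert (Hsin : sin p < sin q) by (apply sin_increasing_1; lra).
  set (m := (1 / p ^ 2 - 1 / q ^ 2) / (1 / sin p ^ 2 - 1 / sin q ^ 2)).
  set (l := 1 / p ^ 2 - m / sin p ^ 2).
  assert (Hden : sin q ^ 2 - sin p ^ 2 <> 0) by nra.
  assert (Kp : above_chord l m p = 0) by (unfold above_chord, l; lra).
  assert (Kq : above_chord l m q = 0)
    by (unfold above_chord, l, m; field; lra).
  set (K' := fun x => 2 * cos x / sin x ^ 3 * (m - slope x)).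
  assert (HK' : forall x, 0 < x < PI / 2 ->
                is_derive (above_chord l m) x (K' x))
    by (intros; apply is_derive_above_chord; assumption).
  assert (Hcoef : forall x, 0 < x < PI / 2 -> 0 < 2 * cos x / sin x ^ 3).
  { intros x Hx. destruct (sin_cos_pos x Hx).
    apply Rdiv_lt_0_compat; [lra | apply pow_lt; lra]. }
  destruct (MVT_cor2 (above_chord l m) K' p q Hpq) as [xi [Hxi Hin]].
  { intros x Hx. apply is_derive_Reals, HK'. lra. }
  assert (Hm : m = slope xi).
  { rewrite Kp, Kq in Hxi. unfold K' in Hxi.
    assert (Hc := Hcoef xi ltac:(lra)).
    assert (E : 2 * cos xi / sin xi ^ 3 * (m - slope xi) = 0) by nra.
    destruct (Rmult_integral _ _ E); lra. }
  assert (Hup : forall x, 0 < x < xi -> 0 < K' x).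
  { intros x Hx. unfold K'. apply Rmult_lt_0_compat; [apply Hcoef; lra |].
    rewrite Hm. pose proof (slope_increasing x xi). lra. }
  assert (Hdown : forall x, xi < x < PI / 2 -> K' x < 0).
  { intros x Hx. unfold K'. assert (Hc := Hcoef x ltac:(lra)).
    rewrite Hm. pose proof (slope_increasing xi x). nra. }
  exists l, m. repeat split; intros x Hx.
  - rewrite <- Kp. apply (lt_of_deriv_pos _ K'); intros; try lra;
      [apply HK' | apply Hup]; lra.
  - destruct (Rle_lt_dec x xi).
    + rewrite <- Kp. apply (lt_of_deriv_pos _ K'); intros; try lra;
        [apply HK' | apply Hup]; lra.
    + rewrite <- Kq. apply (gt_of_deriv_neg _ K'); intros; try lra;
        [apply HK' | apply Hdown]; lra.
  - rewrite <- Kq. apply (gt_of_deriv_neg _ K'); intros; try lra;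
      [apply HK' | apply Hdown]; lra.
Qed.

(** * Uniqueness of the triple of half-angles *)

(** Tangent-line form of the strict convexity of [cot]: the function
    [cot x + x / sin p ^ 2] decreases up to [p] and increases afterwards. *)
Lemma toward_lowers (p x y : R) :
  0 < p < PI / 2 -> 0 < x < PI / 2 ->
  (x <= y <= p \/ p <= y <= x) ->
  x = y \/ cot y + y / sin p ^ 2 < cot x + x / sin p ^ 2.
Proof.
  intros Hp Hx Hxy.
  destruct (Req_dec x y) as [|Hne]; [now left | right].
  set (G := fun t => cot t + t / sin p ^ 2).
  set (G' := fun t => 1 / sin p ^ 2 - 1 / sin t ^ 2).
  assert (HG : forall t, 0 < t < PI / 2 -> is_derive G t (G' t)).
  { intros t Ht. destruct (sin_cos_pos t Ht) as [Hs _].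
    destruct (sin_cos_pos p Hp) as [Hsp _].
    unfold G, G', cot. auto_derive.
    - lra.
    - pose proof (sin2_cos2 t) as E. unfold Rsqr in E.
      replace (1 / sin t ^ 2) with ((sin t * sin t + cos t * cos t) / sin t ^ 2)
        by (rewrite E; reflexivity).
      field. lra. }
  assert (Hlt : forall s t, 0 < s -> s < t -> t < PI / 2 ->
                1 / sin t ^ 2 < 1 / sin s ^ 2).
  { intros s t Hs Hst Ht.
    destruct (sin_cos_pos s) as [Hss _]; [lra |].
    assert (sin s < sin t) by (apply sin_increasing_1; lra).
    unfold Rdiv. rewrite !Rmult_1_l.
    apply Rinv_lt_contravar; [apply Rmult_lt_0_compat; apply pow_lt; lra | nra]. }
  change (G y < G x).
  destruct Hxy as [Hxy | Hxy].
  - apply (gt_of_deriv_neg G G'); [lra | intros; apply HG; lra |].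
    intros t Ht. unfold G'. specialize (Hlt t p). lra.
  - apply (lt_of_deriv_pos G G'); [lra | intros; apply HG; lra |].
    intros t Ht. unfold G'. specialize (Hlt p t). lra.
Qed.

Lemma single_crossing (p a b c a' b' c' : R) :
  0 < p < PI / 2 ->
  0 < a < PI / 2 -> 0 < b < PI / 2 -> 0 < c < PI / 2 ->
  (a <= a' <= p \/ p <= a' <= a) ->
  (b <= b' <= p \/ p <= b' <= b) ->
  (c <= c' <= p \/ p <= c' <= c) ->
  a + b + c = a' + b' + c' ->
  cot a + cot b + cot c = cot a' + cot b' + cot c' ->
  a = a' /\ b = b' /\ c = c'.
Proof.
  intros Hp Ha Hb Hc Ta Tb Tc HS HC.
  assert (HS' : a / sin p ^ 2 + b / sin p ^ 2 + c / sin p ^ 2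
                = a' / sin p ^ 2 + b' / sin p ^ 2 + c' / sin p ^ 2)
    by (unfold Rdiv; rewrite <- !Rmult_plus_distr_r, HS; reflexivity).
  destruct (toward_lowers p a a' Hp Ha Ta) as [<- | La];
  destruct (toward_lowers p b b' Hp Hb Tb) as [<- | Lb];
  destruct (toward_lowers p c c' Hp Hc Tc) as [<- | Lc];
  repeat split; lra.
Qed.

Lemma double_crossing (a b c a' b' c' : R) :
  0 < a -> a <= a' -> a' <= b' -> b' < b -> b <= c -> c < c' -> c' < PI / 2 ->
  a + b + c = a' + b' + c' ->
  cot a + cot b + cot c = cot a' + cot b' + cot c' ->
  1 / a + 1 / b + 1 / c = 1 / a' + 1 / b' + 1 / c' ->
  False.
Proof.
  intros Ha Haa Hab Hbb Hbc Hcc Hc HS HC HR.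
  destruct (chord_signs b' b) as [l [m [K1 [K2 K3]]]]; try lra.
  (* the antiderivative of [above_chord] in the span of [x], [cot x], [1/x] *)
  set (F := fun x => m * cot x - l * x - 1 / x).
  assert (HF : forall x, 0 < x < PI / 2 -> is_derive F x (above_chord l m x)).
  { intros x Hx. destruct (sin_cos_pos x Hx) as [Hs _].
    unfold F, above_chord, cot. auto_derive.
    - repeat split; lra.
    - pose proof (sin2_cos2 x) as E. unfold Rsqr in E.
      replace (m / sin x ^ 2)
        with (m * (sin x * sin x + cos x * cos x) / sin x ^ 2)
        by (rewrite E; field; lra).
      field. lra. }
  assert (Fa : F a' <= F a).
  { destruct (Req_dec a a') as [<- | Hne]; [lra | left].
    apply (gt_of_deriv_neg F (above_chord l m)); [lra | |];
      intros x Hx; [apply HF | apply K1]; lra. }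
  assert (Fb : F b' < F b).
  { apply (lt_of_deriv_pos F (above_chord l m)); [lra | |];
      intros x Hx; [apply HF | apply K2]; lra. }
  assert (Fc : F c' < F c).
  { apply (gt_of_deriv_neg F (above_chord l m)); [lra | |];
      intros x Hx; [apply HF | apply K3]; lra. }
  assert (E : F a + F b + F c = F a' + F b' + F c').
  { unfold F.
    transitivity (m * (cot a + cot b + cot c) - l * (a + b + c)
                  - (1 / a + 1 / b + 1 / c)); [ring |].
    rewrite HC, HS, HR. ring. }
  lra.
Qed.

Lemma sorted_triple_unique (a b c a' b' c' : R) :
  0 < a -> a <= b -> b <= c -> c < PI / 2 ->
  0 < a' -> a' <= b' -> b' <= c' -> c' < PI / 2 ->
  a + b + c = a' + b' + c' ->
  cot a + cot b + cot c = cot a' + cot b' + cot c' ->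
  1 / a + 1 / b + 1 / c = 1 / a' + 1 / b' + 1 / c' ->
  a = a' /\ b = b' /\ c = c'.
Proof.
  (* the hypotheses are symmetric in the two triples *)
  assert (W : forall a b c a' b' c', a <= a' ->
    0 < a -> a <= b -> b <= c -> c < PI / 2 ->
    0 < a' -> a' <= b' -> b' <= c' -> c' < PI / 2 ->
    a + b + c = a' + b' + c' ->
    cot a + cot b + cot c = cot a' + cot b' + cot c' ->
    1 / a + 1 / b + 1 / c = 1 / a' + 1 / b' + 1 / c' ->
    a = a' /\ b = b' /\ c = c').
  { clear. intros a b c a' b' c' Haa. intros.
    destruct (Rle_lt_dec c' c) as [Hcc | Hcc].
    - (* [b'] separates the moves to the right from the moves to the left *)
      apply (single_crossing b'); lra.
    - destruct (Rle_lt_dec b b') as [Hbb | Hbb]; [lra |].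
      exfalso. apply (double_crossing a b c a' b' c'); lra. }
  intros. destruct (Rle_dec a a').
  - apply W; lra.
  - destruct (W a' b' c' a b c) as [? [? ?]]; lra.
Qed.

(** * Half-angles of a triangle *)

Lemma pdist_sym (p q : point) : pdist p q = pdist q p.
Proof. apply distance_symm. Qed.

Lemma pdist_nonneg (p q : point) : 0 <= pdist p q.
Proof. apply sqrt_pos. Qed.

Lemma pdist_sqr (p q : point) :
  pdist p q ^ 2 = (fst p - fst q) ^ 2 + (snd p - snd q) ^ 2.
Proof.
  unfold pdist, dist_euc. rewrite <- Rsqr_pow2, Rsqr_sqrt.
  - unfold Rsqr. ring.
  - apply Rplus_le_le_0_compat; apply Rle_0_sqr.
Qed.

Lemma angle_sym (p q r : point) : angle p q r = angle r q p.
Proof. unfold angle. f_equal. f_equal; ring. Qed.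

Definition cross (p q r : point) : R :=
  (fst q - fst p) * (snd r - snd p) - (snd q - snd p) * (fst r - fst p).

Lemma cross_neq0 (T : plane_triangle) : cross (vA T) (vB T) (vC T) <> 0.
Proof.
  destruct T as [A B C H]; simpl. intro E. apply H. unfold cross in E.
  destruct (Req_dec (fst B) (fst A)) as [Ex |];
    [destruct (Req_dec (snd B) (snd A)) as [Ey |] |].
  - (* [A] and [B] coincide: a line through [A] and [C] will do *)
    destruct (Req_dec (fst C) (fst A));
      [destruct (Req_dec (snd C) (snd A)) |].
    + exists 1, 0, (fst A). repeat split; lra.
    + exists (snd C - snd A), (fst A - fst C),
        ((snd C - snd A) * fst A + (fst A - fst C) * snd A).
      repeat split; [left; lra | rewrite Ex, Ey; ring | ring].
    + exists (snd C - snd A), (fst A - fst C),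
        ((snd C - snd A) * fst A + (fst A - fst C) * snd A).
      repeat split; [right; lra | rewrite Ex, Ey; ring | ring].
  - exists (snd B - snd A), (fst A - fst B),
      ((snd B - snd A) * fst A + (fst A - fst B) * snd A).
    repeat split; [left; lra | ring | lra].
  - exists (snd B - snd A), (fst A - fst B),
      ((snd B - snd A) * fst A + (fst A - fst B) * snd A).
    repeat split; [right; lra | ring | lra].
Qed.

(** [cot (t/2) = (1 + cos t) / sin t] at the angle [t] at [p], whose cosine and
    sine are the dot product and [|cross|] over the product of the two sides;
    the dot product is rewritten by the law of cosines. *)
Lemma cot_half_angle (q p r : point) :
  cross p q r <> 0 ->
  0 < angle q p r / 2 < PI / 2 /\
  cot (angle q p r / 2)
  = ((pdist p q + pdist p r) ^ 2 - pdist q r ^ 2) / (2 * Rabs (cross p q r)).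
Proof.
  intros HD.
  set (D := Rabs (cross p q r)).
  assert (HDpos : 0 < D) by (apply Rabs_pos_lt; assumption).
  assert (HD2 : D ^ 2 = cross p q r ^ 2) by apply pow2_abs.
  set (dot := (fst q - fst p) * (fst r - fst p)
              + (snd q - snd p) * (snd r - snd p)).
  assert (Hb := pdist_nonneg p q). assert (Hc := pdist_nonneg p r).
  assert (Eb := pdist_sqr p q). assert (Ec := pdist_sqr p r).
  assert (Ea := pdist_sqr q r).
  change (angle q p r) with (acos (dot / (pdist p q * pdist p r))).
  set (b := pdist p q) in *. set (c := pdist p r) in *.
  set (a := pdist q r) in *.
  assert (Lagrange : dot ^ 2 + D ^ 2 = (b * c) ^ 2).
  { rewrite HD2, Rpow_mult_distr, Eb, Ec. unfold dot, cross. ring. }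
  assert (Hcos : 2 * dot = b ^ 2 + c ^ 2 - a ^ 2).
  { rewrite Ea, Eb, Ec. unfold dot. ring. }
  assert (Hbc : 0 < b * c).
  { destruct (Rmult_le_pos b c Hb Hc) as [| E0]; [assumption |].
    rewrite <- E0 in Lagrange. nra. }
  assert (Hb0 : b <> 0) by (intro E0; rewrite E0 in Hbc; lra).
  assert (Hc0 : c <> 0) by (intro E0; rewrite E0 in Hbc; lra).
  set (k := dot / (b * c)).
  assert (Ek : dot = k * (b * c)) by (unfold k; field; auto).
  assert (Hk1 : k ^ 2 + (D / (b * c)) ^ 2 = 1).
  { unfold k.
    replace ((dot / (b * c)) ^ 2 + (D / (b * c)) ^ 2)
      with ((dot ^ 2 + D ^ 2) / (b * c) ^ 2) by (field; auto).
    rewrite Lagrange. field. auto. }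
  assert (HDbc : 0 < D / (b * c)) by (apply Rdiv_lt_0_compat; assumption).
  assert (Hk : -1 < k < 1) by nra.
  destruct (acos_bound_lt k Hk) as [Hlo Hhi].
  assert (Hhalf : 0 < acos k / 2 < PI / 2) by lra.
  split; [assumption |].
  assert (Hsin : sin (acos k) = D / (b * c)).
  { rewrite sin_acos by lra. apply sqrt_lem_1; unfold Rsqr; nra. }
  destruct (sin_cos_pos _ Hhalf) as [Hs2 Hc2].
  assert (E2s : sin (acos k) = 2 * sin (acos k / 2) * cos (acos k / 2)).
  { rewrite <- sin_2a. f_equal. field. }
  assert (E2c : k = 2 * cos (acos k / 2) * cos (acos k / 2) - 1).
  { rewrite <- cos_2a_cos.
    transitivity (cos (acos k)); [symmetry; apply cos_acos; lra |].
    f_equal. field. }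
  set (h := acos k / 2) in *.
  transitivity ((1 + k) / (D / (b * c))).
  - rewrite <- Hsin, E2s. rewrite E2c at 1. unfold cot. field. lra.
  - replace ((b + c) ^ 2 - a ^ 2) with (2 * (b * c + dot))
      by (rewrite Rmult_plus_distr_l, Hcos; ring).
    rewrite Ek. field. repeat split; auto; lra.
Qed.

(** [cos (x + y + z)] is [sin x sin y sin z] times the difference between the
    product and the sum of the cotangents. *)
Lemma sum_eq_PI2 (x y z : R) :
  0 < x < PI / 2 -> 0 < y < PI / 2 -> 0 < z < PI / 2 ->
  cot x + cot y + cot z = cot x * cot y * cot z ->
  x + y + z = PI / 2.
Proof.
  intros Hx Hy Hz E.
  destruct (sin_cos_pos x Hx). destruct (sin_cos_pos y Hy).
  destruct (sin_cos_pos z Hz).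
  assert (Hcos : cos (x + y + z) = 0).
  { rewrite !cos_plus, sin_plus.
    transitivity (sin x * sin y * sin z
      * (cot x * cot y * cot z - (cot x + cot y + cot z))).
    - unfold cot. field. lra.
    - rewrite E. ring. }
  destruct (Rtotal_order (x + y + z) (PI / 2)) as [L | [L | L]]; auto.
  - pose proof (cos_gt_0 (x + y + z)). lra.
  - pose proof (cos_lt_0 (x + y + z)). lra.
Qed.

Definition side_a (T : plane_triangle) : R := pdist (vB T) (vC T).
Definition side_b (T : plane_triangle) : R := pdist (vC T) (vA T).
Definition side_c (T : plane_triangle) : R := pdist (vA T) (vB T).

Lemma area_pos (T : plane_triangle) : 0 < area T.
Proof.
  unfold area. apply Rdiv_lt_0_compat; [| lra].
  apply Rabs_pos_lt. apply cross_neq0.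
Qed.

Lemma perimeter_pos (T : plane_triangle) : 0 < perimeter T.
Proof.
  unfold perimeter.
  pose proof (pdist_nonneg (vA T) (vB T)).
  pose proof (pdist_nonneg (vB T) (vC T)).
  pose proof (pdist_nonneg (vC T) (vA T)) as [H1 | H1]; [lra |].
  (* a triangle with [C] equal to [A] would be degenerate *)
  exfalso. apply (cross_neq0 T).
  pose proof (pdist_sqr (vC T) (vA T)) as E. rewrite <- H1 in E.
  destruct (Rplus_sqr_eq_0 (fst (vC T) - fst (vA T)) (snd (vC T) - snd (vA T)))
    as [Ex Ey]; [unfold Rsqr; lra |].
  unfold cross. rewrite Ex, Ey. ring.
Qed.

(** These are the formulas [cot (alpha / 2) = s (s - a) / A], written with the
    perimeter [P = 2 s]. *)
Lemma cot_half_angles (T : plane_triangle) :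
  let P := perimeter T in let A := area T in
  (0 < alpha T / 2 < PI / 2 /\
   cot (alpha T / 2) = P * (P - 2 * side_a T) / (4 * A)) /\
  (0 < beta T / 2 < PI / 2 /\
   cot (beta T / 2) = P * (P - 2 * side_b T) / (4 * A)) /\
  (0 < gamma T / 2 < PI / 2 /\
   cot (gamma T / 2) = P * (P - 2 * side_c T) / (4 * A)).
Proof.
  intros P A.
  assert (HX := cross_neq0 T).
  assert (HA : A = Rabs (cross (vA T) (vB T) (vC T)) / 2) by reflexivity.
  assert (HA0 := area_pos T). fold A in HA0.
  (* the cross product is invariant under cyclic permutation of the vertices *)
  assert (EB : cross (vB T) (vC T) (vA T) = cross (vA T) (vB T) (vC T))
    by (unfold cross; ring).
  assert (EC : cross (vC T) (vA T) (vB T) = cross (vA T) (vB T) (vC T))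
    by (unfold cross; ring).
  destruct (cot_half_angle (vB T) (vA T) (vC T) HX) as [Ra Ca].
  destruct (cot_half_angle (vC T) (vB T) (vA T)) as [Rb Cb];
    [now rewrite EB |].
  destruct (cot_half_angle (vA T) (vC T) (vB T)) as [Rc Cc];
    [now rewrite EC |].
  rewrite EB in Cb. rewrite EC in Cc.
  replace (Rabs (cross (vA T) (vB T) (vC T))) with (2 * A) in Ca, Cb, Cc
    by (rewrite HA; field).
  unfold alpha, beta, gamma, side_a, side_b, side_c.
  rewrite Ca, Cb, Cc. unfold P, perimeter.
  rewrite (pdist_sym (vA T) (vC T)), (pdist_sym (vB T) (vA T)),
    (pdist_sym (vC T) (vB T)).
  repeat split; try tauto; field; lra.
Qed.

Lemma heron (T : plane_triangle) :
  16 * area T ^ 2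
  = perimeter T * (perimeter T - 2 * side_a T) * (perimeter T - 2 * side_b T)
    * (perimeter T - 2 * side_c T).
Proof.
  set (X := cross (vA T) (vB T) (vC T)).
  assert (HA : 16 * area T ^ 2 = 4 * X ^ 2).
  { change (area T) with (Rabs X / 2).
    rewrite <- (pow2_abs X). field. }
  rewrite HA. unfold perimeter, side_a, side_b, side_c.
  pose proof (pdist_sqr (vA T) (vB T)) as Ec.
  pose proof (pdist_sqr (vB T) (vC T)) as Ea.
  pose proof (pdist_sqr (vC T) (vA T)) as Eb.
  set (a := pdist (vB T) (vC T)) in *.
  set (b := pdist (vC T) (vA T)) in *.
  set (c := pdist (vA T) (vB T)) in *.
  transitivity (4 * b ^ 2 * c ^ 2 - (b ^ 2 + c ^ 2 - a ^ 2) ^ 2); [| ring].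
  rewrite Ea, Eb, Ec. unfold X, cross. ring.
Qed.

Lemma sum_cot_half_angles (T : plane_triangle) :
  cot (alpha T / 2) + cot (beta T / 2) + cot (gamma T / 2)
  = perimeter T ^ 2 / (4 * area T).
Proof.
  destruct (cot_half_angles T) as [[_ Ca] [[_ Cb] [_ Cc]]].
  pose proof (area_pos T).
  rewrite Ca, Cb, Cc.
  replace (side_c T) with (perimeter T - side_a T - side_b T)
    by (unfold perimeter, side_a, side_b, side_c; ring).
  field. lra.
Qed.

Lemma sum_half_angles (T : plane_triangle) :
  alpha T / 2 + beta T / 2 + gamma T / 2 = PI / 2.
Proof.
  pose proof (sum_cot_half_angles T) as HS.
  destruct (cot_half_angles T) as [[Ra Ca] [[Rb Cb] [Rc Cc]]].
  apply sum_eq_PI2; auto.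
  rewrite HS, Ca, Cb, Cc. pose proof (area_pos T).
  set (P := perimeter T) in *. set (A := area T) in *.
  transitivity (P ^ 2 * (16 * A ^ 2) / (64 * A ^ 3)); [field; lra |].
  unfold A at 1. rewrite heron. fold P. field. lra.
Qed.

(** * Congruence from equal sides *)

(** The affine map matching the vertices, written in the coordinates along the
    edges at [A], preserves distances because the law of cosines recovers the
    dot product of these edges from the sides. *)
Lemma congruent_SSS (T1 T2 : plane_triangle) :
  side_a T1 = side_a T2 -> side_b T1 = side_b T2 -> side_c T1 = side_c T2 ->
  congruent T1 T2.
Proof.
  intros Ha Hb Hc.
  assert (HX := cross_neq0 T1).
  assert (Ea : side_a T1 ^ 2 = side_a T2 ^ 2) by now rewrite Ha.
  assert (Eb : side_b T1 ^ 2 = side_b T2 ^ 2) by now rewrite Hb.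
  assert (Ec : side_c T1 ^ 2 = side_c T2 ^ 2) by now rewrite Hc.
  clear Ha Hb Hc. unfold side_a, side_b, side_c in *.
  rewrite !pdist_sqr in *. unfold congruent, region.
  destruct T1 as [[ax ay] [bx by_] [cx cy] ?], T2 as [[ax' ay'] [bx' by'] [cx' cy'] ?].
  unfold cross in HX. simpl in *.
  set (D := (bx - ax) * (cy - ay) - (by_ - ay) * (cx - ax)) in *.
  set (u := fun p : point => ((fst p - ax) * (cy - ay) - (snd p - ay) * (cx - ax)) / D).
  set (v := fun p : point => ((bx - ax) * (snd p - ay) - (by_ - ay) * (fst p - ax)) / D).
  set (f := fun p : point => (ax' + u p * (bx' - ax') + v p * (cx' - ax'),
                              ay' + u p * (by' - ay') + v p * (cy' - ay'))).
  assert (Haff : forall s t w, s + t + w = 1 ->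
    f (s * ax + t * bx + w * cx, s * ay + t * by_ + w * cy)
    = (s * ax' + t * bx' + w * cx', s * ay' + t * by' + w * cy')).
  { intros s t w E. replace s with (1 - t - w) by lra.
    assert (Hu : u ((1 - t - w) * ax + t * bx + w * cx,
                    (1 - t - w) * ay + t * by_ + w * cy) = t)
      by (unfold u; simpl; unfold D in *; field; assumption).
    assert (Hv : v ((1 - t - w) * ax + t * bx + w * cx,
                    (1 - t - w) * ay + t * by_ + w * cy) = w)
      by (unfold v; simpl; unfold D in *; field; assumption).
    unfold f. rewrite Hu, Hv. f_equal; ring. }
  exists f. split.
  - intros p q.
    assert (H : pdist (f p) (f q) ^ 2 = pdist p q ^ 2).
    { rewrite !pdist_sqr.
      assert (Hx : fst p - fst q = (u p - u q) * (bx - ax) + (v p - v q) * (cx - ax))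
        by (unfold u, v, D in *; field; assumption).
      assert (Hy : snd p - snd q = (u p - u q) * (by_ - ay) + (v p - v q) * (cy - ay))
        by (unfold u, v, D in *; field; assumption).
      rewrite Hx, Hy. unfold f; simpl fst; simpl snd.
      generalize (u p) (u q) (v p) (v q). clear - Ea Eb Ec.
      intros u1 u2 v1 v2.
      set (du := u1 - u2). set (dv := v1 - v2).
      transitivity (du ^ 2 * ((ax' - bx') ^ 2 + (ay' - by') ^ 2)
        + du * dv * (((ax' - bx') ^ 2 + (ay' - by') ^ 2)
                     + ((cx' - ax') ^ 2 + (cy' - ay') ^ 2)
                     - ((bx' - cx') ^ 2 + (by' - cy') ^ 2))
        + dv ^ 2 * ((cx' - ax') ^ 2 + (cy' - ay') ^ 2));
        [unfold du, dv; ring |].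
      simpl in Ea, Eb, Ec |- *.
      rewrite <- Ea, <- Eb, <- Ec. unfold du, dv. ring. }
    pose proof (pdist_nonneg (f p) (f q)). pose proof (pdist_nonneg p q). nra.
  - intros [qx qy]. split.
    + intros (s & t & w & Hs & Ht & Hw & E & Ex & Ey). simpl in Ex, Ey.
      exists (s * ax + t * bx + w * cx, s * ay + t * by_ + w * cy). split.
      * exists s, t, w. repeat split; assumption.
      * rewrite Haff by assumption. now rewrite Ex, Ey.
    + intros [[px py] [(s & t & w & Hs & Ht & Hw & E & Ex & Ey) Hf]].
      simpl in Ex, Ey. rewrite Ex, Ey, Haff in Hf by assumption.
      injection Hf as <- <-.
      exists s, t, w. repeat split; assumption.
Qed.

(** * Sorting the angles *)

Definition relabeled (T T' : plane_triangle) : Prop :=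
  (forall p, region T p <-> region T' p) /\
  area T = area T' /\ perimeter T = perimeter T' /\
  sum_recip_angles T = sum_recip_angles T'.

Lemma relabeled_trans (T1 T2 T3 : plane_triangle) :
  relabeled T1 T2 -> relabeled T2 T3 -> relabeled T1 T3.
Proof.
  intros (H1 & H2 & H3 & H4) (K1 & K2 & K3 & K4).
  repeat split; try congruence; intros H.
  - apply K1, H1, H.
  - apply H1, K1, H.
Qed.

Lemma swap_AB (T : plane_triangle) :
  exists T', relabeled T T' /\
    alpha T' = beta T /\ beta T' = alpha T /\ gamma T' = gamma T.
Proof.
  destruct T as [A B C H].
  assert (H' : ~ collinear B A C).
  { intros (a & b & c & Hab & HB & HA & HC). apply H. exists a, b, c. tauto. }
  exists (PlaneTriangle B A C H').
  unfold relabeled, region, area, perimeter, sum_recip_angles, alpha, beta, gamma.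
  simpl.
  rewrite (angle_sym A B C), (angle_sym B A C), (angle_sym B C A).
  rewrite (pdist_sym A B), (pdist_sym B C), (pdist_sym C A).
  repeat split; try ring.
  - intros (s & t & u & Hr). exists t, s, u. lra.
  - intros (s & t & u & Hr). exists t, s, u. lra.
  - f_equal. rewrite <- Rabs_Ropp. f_equal. ring.
Qed.

Lemma swap_BC (T : plane_triangle) :
  exists T', relabeled T T' /\
    alpha T' = alpha T /\ beta T' = gamma T /\ gamma T' = beta T.
Proof.
  destruct T as [A B C H].
  assert (H' : ~ collinear A C B).
  { intros (a & b & c & Hab & HA & HC & HB). apply H. exists a, b, c. tauto. }
  exists (PlaneTriangle A C B H').
  unfold relabeled, region, area, perimeter, sum_recip_angles, alpha, beta, gamma.
  simpl.
  rewrite (angle_sym C A B), (angle_sym B C A), (angle_sym A B C).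
  rewrite (pdist_sym A B), (pdist_sym B C), (pdist_sym C A).
  repeat split; try ring.
  - intros (s & t & u & Hr). exists s, u, t. lra.
  - intros (s & t & u & Hr). exists s, u, t. lra.
  - f_equal. rewrite <- Rabs_Ropp. f_equal. ring.
Qed.

(** The half-angles are determined only as an unordered triple; choosing the
    order by size makes equal triples agree entry by entry. *)
Lemma sorted_relabeling (T : plane_triangle) :
  exists T', relabeled T T' /\ alpha T' <= beta T' <= gamma T'.
Proof.
  assert (S1 : exists T', relabeled T T' /\ alpha T' <= beta T').
  { destruct (Rle_lt_dec (alpha T) (beta T)).
    - exists T. split; [repeat split; auto | assumption].
    - destruct (swap_AB T) as (T' & HT & Ea & Eb & _).
      exists T'. split; [assumption | lra]. }
  destruct S1 as (T1 & R1 & L1).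
  destruct (Rle_lt_dec (beta T1) (gamma T1)); [exists T1; split; auto |].
  destruct (swap_BC T1) as (T2 & R2 & Ea & Eb & Ec).
  destruct (Rle_lt_dec (alpha T2) (beta T2)).
  - exists T2. split; [apply (relabeled_trans _ T1); assumption | lra].
  - destruct (swap_AB T2) as (T3 & R3 & Fa & Fb & Fc).
    exists T3. split; [| lra].
    apply (relabeled_trans _ T1), (relabeled_trans _ T2); assumption.
Qed.

(** * Angles and perimeter determine the sides *)

Lemma congruent_of_sorted (T1 T2 : plane_triangle) :
  alpha T1 <= beta T1 <= gamma T1 ->
  alpha T2 <= beta T2 <= gamma T2 ->
  area T1 = area T2 ->
  perimeter T1 = perimeter T2 ->
  sum_recip_angles T1 = sum_recip_angles T2 ->
  congruent T1 T2.
Proof.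
  intros O1 O2 HA HP HR.
  pose proof (sum_half_angles T1) as S1. pose proof (sum_half_angles T2) as S2.
  pose proof (sum_cot_half_angles T1) as C1.
  pose proof (sum_cot_half_angles T2) as C2.
  destruct (cot_half_angles T1) as [[Ra1 Ca1] [[Rb1 Cb1] [Rc1 Cc1]]].
  destruct (cot_half_angles T2) as [[Ra2 Ca2] [[Rb2 Cb2] [Rc2 Cc2]]].
  assert (Hrecip : forall x, 0 < x / 2 -> 1 / (x / 2) = 2 * (1 / x))
    by (intros x Hx; field; lra).
  unfold sum_recip_angles in HR.
  destruct (sorted_triple_unique
              (alpha T1 / 2) (beta T1 / 2) (gamma T1 / 2)
              (alpha T2 / 2) (beta T2 / 2) (gamma T2 / 2))
    as (Ea & Eb & Ec); try lra.
  { rewrite C1, C2, HA, HP. reflexivity. }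
  { rewrite !Hrecip by lra. lra. }
  pose proof (area_pos T2). pose proof (perimeter_pos T2).
  assert (Hinj : forall x y,
    perimeter T2 * (perimeter T2 - 2 * x) / (4 * area T2)
    = perimeter T2 * (perimeter T2 - 2 * y) / (4 * area T2) -> x = y).
  { intros x y E.
    apply (Rmult_eq_compat_r (4 * area T2)) in E.
    unfold Rdiv in E. rewrite !Rmult_assoc, Rinv_l, !Rmult_1_r in E by lra.
    apply Rmult_eq_reg_l in E; lra. }
  rewrite HA, HP in *.
  apply congruent_SSS; apply Hinj; congruence.
Qed.

Theorem theorem1 (T1 T2 : plane_triangle)
  (hA : area T1 = area T2)
  (hP : perimeter T1 = perimeter T2)
  (hR : sum_recip_angles T1 = sum_recip_angles T2) :
  congruent T1 T2.
Proof.
  destruct (sorted_relabeling T1) as (T1' & (G1 & A1 & P1 & R1) & O1).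
  destruct (sorted_relabeling T2) as (T2' & (G2 & A2 & P2 & R2) & O2).
  destruct (congruent_of_sorted T1' T2') as (f & Hf & Hreg); try congruence.
  exists f. split; [assumption |].
  intros q. rewrite G2, Hreg.
  split; intros (p & Hp & E); exists p; split; auto; apply G1; assumption.
Qed.
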